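(* Let $\delta\in\{1,-1,0\}$ and let $\mathbf{M}_\delta$ be a spacelike Weingarten rotational surface in $\mathbb{S}^3_1$ (spherical for $\delta=1$, hyperbolic of the first kind for $\delta=-1$, parabolic for $\delta=0$), with profile curve parameterized by the principal curvature $\lambda$, whose principal curvatures satisfy $\kappa=\frac a\lambda$. Let $$\Psi_1(\lambda,\delta)=\psi_0\pm c^2\int\frac{\lambda^2\,d\lambda}{\sqrt{\lambda^2-a}\,(c^2-\delta(\lambda^2-a))\sqrt{(\lambda^2-1)c^2+\delta(\lambda^2-a)}}$$ for constants $\psi_0$, $a$ and $c>0$. Then the coordinate functions of the profile curve of $\mathbf{M}_\delta$ with constant Gaussian curvature in $\mathbb{S}^3_1$, parameterized with respect to $\lambda$, are given by one of the following. 1. For $\delta=1$: (a) $y(\lambda)=\frac{c}{\sqrt{\lambda^2-a}}$, $z(\lambda)=\sqrt{1-y^2(\lambda)}\cosh\Psi_1(\lambda,1)$, $w(\lambda)=\sqrt{1-y^2(\lambda)}\sinh\Psi_1(\lambda,1)$ where i) $\lambda<-\sqrt{c^2+a}$ or $\lambda>\sqrt{c^2+a}$ for $a>-c^2$; ii) $\lambda\in\mathbb{R}$ for $a\le-c^2$; (b) $y(\lambda)=\frac{c}{\sqrt{\lambda^2-a}}$, $z(\lambda)=\sqrt{y^2(\lambda)-1}\sinh\Psi_1(\lambda,1)$, $w(\lambda)=\sqrt{y^2(\lambda)-1}\cosh\Psi_1(\lambda,1)$ where i) $-\sqrt{c^2+a}<\lambda<-\sqrt{\frac{c^2+a}{c^2+1}}$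 or $\sqrt{\frac{c^2+a}{c^2+1}}<\lambda<\sqrt{c^2+a}$ for $-c^2<a<1$; ii) $-\sqrt{c^2+a}<\lambda<-\sqrt a$ or $\sqrt a<\lambda<\sqrt{c^2+a}$ for $a>1$. 2. For $\delta=-1$: $w(\lambda)=\frac{c}{\sqrt{\lambda^2-a}}$, $x(\lambda)=\sqrt{1+w^2(\lambda)}\cos\Psi_1(\lambda,-1)$, $y(\lambda)=\sqrt{1+w^2(\lambda)}\sin\Psi_1(\lambda,-1)$ where i) $\lambda<-\sqrt a$ or $\lambda>\sqrt a$ for $a>1$ and $c>1$; ii) $\lambda<-\sqrt{\frac{c^2-a}{c^2-1}}$ or $\lambda>\sqrt{\frac{c^2-a}{c^2-1}}$ for $a<1<c^2$. 3. For $\delta=0$: $z(\lambda)=\frac{c}{\sqrt{\lambda^2-a}}$, $x(\lambda)=\Psi_1(\lambda,0)z(\lambda)$, $w(\lambda)=\frac{1-x^2(\lambda)}{2z(\lambda)}$ with i) $\lambda<-\sqrt a$ or $\lambda>\sqrt a$ for $a>1$; ii) $\lambda<-1$ or $\lambda>1$ for $a\le1$.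
   Context: $\mathbb{E}^4_1$ is 4-dimensional Minkowski space with metric $\tilde g$, and $\mathbb{S}^3_1=\{\mathbf{x}\in\mathbb{E}^4_1:\tilde g(\mathbf{x},\mathbf{x})=1\}$ is de Sitter space. For $\delta=\pm1$ coordinates are used in which $\tilde g(\mathbf{x},\mathbf{y})=x_1y_1+x_2y_2+x_3y_3-x_4y_4$; for $\delta=0$, coordinates in which $\tilde g(\mathbf{x},\mathbf{y})=x_1y_1+x_2y_2+x_3y_4+x_4y_3$. Rotational surfaces $\mathbf{M}_\delta$, with $u\in J$ the arc length parameter of the profile curve $C$, $\tilde g(C',C')=\varepsilon=\pm1$, $'=d/du$: - Spherical, $\mathbf{M}_1$: $r(u,v)=(y\sin v,y\cos v,z,w)$, $v\in[0,2\pi]$, $y>0$, $y^2+z^2-w^2=1$, $y'^2+z'^2-w'^2=\varepsilon$; induced metric $\varepsilon du^2+y^2dv^2$; $z',w'$ nonzero. - Hyperbolic of the first kind, $\mathbf{M}_{-1}$: $r(u,v)=(x,y,w\sinh v,w\cosh v)$, $v\in\mathbb{R}$, $w>0$, $x^2+y^2-w^2=1$, $x'^2+y'^2-w'^2=\varepsilon$; induced metric $\varepsilon du^2+w^2dv^2$; $x',y'$ nonzero. - Parabolic, $\mathbf{M}_0$: $r(u,v)=(x,vz,z,-\tfrac12v^2z+w)$, $v\in\mathbb{R}$, $z>0$, $2zw+x^2=1$, $2z'w'+x'^2=\varepsilon$; induced metric $\varepsilon du^2+z^2dv^2$; $x',z'$ nonzero. Here $x,y,z,w$ are functions of $u$,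 and the surfaces are assumed not contained in a hyperplane of $\mathbb{E}^4_1$. The surface is spacelike if $\varepsilon=1$ and timelike if $\varepsilon=-1$. ''Parameterized with respect to $\lambda$'' means $\lambda$ replaces $u$ as parameter of the profile curve; the coordinate functions become functions of $\lambda$. Principal curvatures: with $N$ a unit normal field of the surface in $\mathbb{S}^3_1$, $\kappa=\tilde g(r_{uu},N)$ and $\lambda=\tilde g(r_{vv},N)/\tilde g(r_v,r_v)$; the eigenvalues of the shape operator are $\varepsilon\kappa,\lambda$. Convention: $\lambda$ ranges over an open interval on which the displayed expressions are real and well defined, i.e. $\lambda^2-a>0$, $c^2-\delta(\lambda^2-a)\ne0$ and $(\lambda^2-1)c^2+\delta(\lambda^2-a)>0$. The integral denotes an antiderivative in $\lambda$.
   Formalization: For δ=1, z and w are given up to a common sign ±1 (the isometry (z,w)→(−z,−w)); parameter cases missing from the list are added: δ=1(b) with a=1; δ=−1 with a=1<c, with a>1 and c=1, and with a>1 and c<1. *)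

(* Defs.v *)
(* Concrete reals of the standard library, with Coquelicot for derivatives. *)
From Stdlib Require Import Reals.
From Coquelicot Require Import Coquelicot.
Open Scope R_scope.

Definition open_interval (I : R -> Prop) : Prop :=
  exists p q : Rbar, Rbar_lt p q /\
    forall t : R, I t <-> Rbar_lt p t /\ Rbar_lt t q.

Definition C2_on (J : R -> Prop) (f : R -> R) : Prop :=
  forall t, J t ->
    ex_derive f t /\ ex_derive (Derive f) t /\ continuous (Derive (Derive f)) t.

Definition E41 : Type := (R * R * R * R)%type.
Definition c1 (p : E41) : R := fst (fst (fst p)).
Definition c2 (p : E41) : R := snd (fst (fst p)).
Definition c3 (p : E41) : R := snd (fst p).
Definition c4 (p : E41) : R := snd p.

Definition Dvec (f : R -> E41) (t : R) : E41 :=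
  (Derive (fun s => c1 (f s)) t, Derive (fun s => c2 (f s)) t,
   Derive (fun s => c3 (f s)) t, Derive (fun s => c4 (f s)) t).

Inductive rot_kind : Set := spherical | hyperbolic1 | parabolic.

Definition delta (k : rot_kind) : R :=
  match k with spherical => 1 | hyperbolic1 => -1 | parabolic => 0 end.

(* The Minkowski metric; in the parabolic case the last two coordinates are
   null coordinates. *)
Definition mink (k : rot_kind) (p q : E41) : R :=
  match k with
  | parabolic => c1 p * c1 q + c2 p * c2 q + c3 p * c4 q + c4 p * c3 q
  | _ => c1 p * c1 q + c2 p * c2 q + c3 p * c3 q - c4 p * c4 q
  end.

(* Each kind uses three of the functions x, y, z, w: the function x is
   irrelevant for [spherical], z for [hyperbolic1] and y for [parabolic].
   The profile curve is v = 0. *)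
Definition surf (k : rot_kind) (x y z w : R -> R) (u v : R) : E41 :=
  match k with
  | spherical => (y u * sin v, y u * cos v, z u, w u)
  | hyperbolic1 => (x u, y u, w u * sinh v, w u * cosh v)
  | parabolic => (x u, v * z u, z u, - (1 / 2) * v ^ 2 * z u + w u)
  end.

Definition v_domain (k : rot_kind) (v : R) : Prop :=
  match k with spherical => 0 <= v <= 2 * PI | _ => True end.

Definition radius (k : rot_kind) (x y z w : R -> R) : R -> R :=
  match k with spherical => y | hyperbolic1 => w | parabolic => z end.

Definition not_identically_zero (J : R -> Prop) (f : R -> R) : Prop :=
  exists t, J t /\ f t <> 0.

(* eps = 1: spacelike surface; eps = -1: timelike surface. *)
Record rotational_surface (k : rot_kind) (eps : R) (J : R -> Prop)
    (x y z w : R -> R) : Prop := {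
  rs_interval : open_interval J;
  rs_C2 : let C := fun u => surf k x y z w u 0 in
    C2_on J (fun u => c1 (C u)) /\ C2_on J (fun u => c2 (C u)) /\
    C2_on J (fun u => c3 (C u)) /\ C2_on J (fun u => c4 (C u));
  rs_radius : forall u, J u -> 0 < radius k x y z w u;
  rs_deSitter : forall u, J u ->
    let C := fun u => surf k x y z w u 0 in mink k (C u) (C u) = 1;
  rs_arc_length : forall u, J u ->
    let C := fun u => surf k x y z w u 0 in
    mink k (Dvec C u) (Dvec C u) = eps;
  rs_nonzero :
    match k with
    | spherical =>
        not_identically_zero J (Derive z) /\ not_identically_zero J (Derive w)
    | hyperbolic1 =>
        not_identically_zero J (Derive x) /\ not_identically_zero J (Derive y)
    | parabolic =>
        not_identically_zero J (Derive x) /\ not_identically_zero J (Derive z)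
    end;
  rs_no_hyperplane :
    ~ exists (n : E41) (d : R), n <> (0, 0, 0, 0) /\
        forall u v, J u -> v_domain k v -> mink k n (surf k x y z w u v) = d
}.

Definition surf_u k x y z w (u v : R) : E41 :=
  Dvec (fun t => surf k x y z w t v) u.
Definition surf_v k x y z w (u v : R) : E41 :=
  Dvec (fun t => surf k x y z w u t) v.
Definition surf_uu k x y z w (u v : R) : E41 :=
  Dvec (fun t => surf_u k x y z w t v) u.
Definition surf_vv k x y z w (u v : R) : E41 :=
  Dvec (fun t => surf_v k x y z w u t) v.

(* Unit normal field of the surface inside de Sitter space: N is also
   orthogonal to the position vector. *)
Definition unit_normal (k : rot_kind) (J : R -> Prop) (x y z w : R -> R)
    (N : R -> R -> E41) : Prop :=
  forall u v, J u -> v_domain k v ->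
    Rabs (mink k (N u v) (N u v)) = 1 /\
    mink k (N u v) (surf k x y z w u v) = 0 /\
    mink k (N u v) (surf_u k x y z w u v) = 0 /\
    mink k (N u v) (surf_v k x y z w u v) = 0.

Definition kappa k x y z w (N : R -> R -> E41) (u v : R) : R :=
  mink k (surf_uu k x y z w u v) (N u v).

Definition lambda k x y z w (N : R -> R -> E41) (u v : R) : R :=
  mink k (surf_vv k x y z w u v) (N u v) /
  mink k (surf_v k x y z w u v) (surf_v k x y z w u v).

(* Gaussian curvature of the induced metric eps du^2 + rho^2 dv^2, where
   rho^2 = g(r_v, r_v). *)
Definition gauss_curvature (k : rot_kind) (eps : R) (x y z w : R -> R)
    (u v : R) : R :=
  let rho := fun t =>
    sqrt (mink k (surf_v k x y z w t v) (surf_v k x y z w t v)) in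
  - eps * Derive (Derive rho) u / rho u.

(* U expresses the arc length u as a function of lambda, which becomes the
   parameter of the profile curve, ranging over I. *)
Definition parameterized_by_lambda (k : rot_kind) (J I : R -> Prop)
    (x y z w : R -> R) (N : R -> R -> E41) (U : R -> R) : Prop :=
  open_interval I /\
  (forall l, I l -> J (U l) /\ ex_derive U l) /\
  (forall u, J u -> exists l, I l /\ U l = u) /\
  (forall l v, I l -> v_domain k v -> lambda k x y z w N (U l) v = l).

Definition Psi1_integrand (k : rot_kind) (a c l : R) : R :=
  l ^ 2 /
  (sqrt (l ^ 2 - a) * (c ^ 2 - delta k * (l ^ 2 - a)) *
   sqrt ((l ^ 2 - 1) * c ^ 2 + delta k * (l ^ 2 - a))).

(* Psi = psi0 +/- c^2 (antiderivative of the integrand) on I. *)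
Definition is_Psi1 (k : rot_kind) (I : R -> Prop) (a c psi0 : R)
    (Psi : R -> R) : Prop :=
  exists (s : R) (F : R -> R),
    (s = 1 \/ s = -1) /\
    (forall l, I l -> is_derive F l (Psi1_integrand k a c l)) /\
    (forall l, I l -> Psi l = psi0 + s * c ^ 2 * F l).

Definition well_defined_at (k : rot_kind) (a c l : R) : Prop :=
  0 < l ^ 2 - a /\
  c ^ 2 - delta k * (l ^ 2 - a) <> 0 /\
  0 < (l ^ 2 - 1) * c ^ 2 + delta k * (l ^ 2 - a).

Definition outside (b l : R) : Prop := l < - b \/ b < l.
Definition between (b b' l : R) : Prop := - b' < l < - b \/ b < l < b'.

Definition range_spherical_a (a c l : R) : Prop :=
  (- c ^ 2 < a /\ outside (sqrt (c ^ 2 + a)) l) \/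
  a <= - c ^ 2 (* every real l *).

(* The last alternative, a = 1, is not covered by the two cases
   -c^2 < a < 1 and a > 1, although such (flat) surfaces exist. *)
Definition range_spherical_b (a c l : R) : Prop :=
  (- c ^ 2 < a < 1 /\
     between (sqrt ((c ^ 2 + a) / (c ^ 2 + 1))) (sqrt (c ^ 2 + a)) l) \/
  (1 < a /\ between (sqrt a) (sqrt (c ^ 2 + a)) l) \/
  (a = 1 /\ between 1 (sqrt (c ^ 2 + 1)) l).

(* The last three alternatives are the parameter values not covered by the
   cases "a > 1 and c > 1" and "a < 1 < c^2" for which surfaces exist, since
   w'^2 = (a - 1) w^2 + c^2 - 1 has solutions w > 0 for them. *)
Definition range_hyperbolic1 (a c l : R) : Prop :=
  (1 < a /\ 1 < c /\ outside (sqrt a) l) \/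
  (a < 1 /\ 1 < c ^ 2 /\ outside (sqrt ((c ^ 2 - a) / (c ^ 2 - 1))) l) \/
  (a = 1 /\ 1 < c /\ outside 1 l) \/
  (1 < a /\ c = 1 /\ outside (sqrt a) l) \/
  (1 < a /\ c < 1 /\
     between (sqrt a) (sqrt ((a - c ^ 2) / (1 - c ^ 2))) l).

Definition range_parabolic (a l : R) : Prop :=
  (1 < a /\ outside (sqrt a) l) \/ (a <= 1 /\ outside 1 l).

(* X, Y, Z, W are the coordinate functions of the profile curve, as functions
   of l = lambda.  The sign eta accounts for the isometry (z,w) -> (-z,-w),
   which preserves spherical rotational surfaces, their parameters and their
   principal curvatures: eta is the sign of z when y < 1 and of w when y > 1. *)
Definition coordinate_formulas (k : rot_kind) (I : R -> Prop) (a c : R)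
    (Psi X Y Z W : R -> R) : Prop :=
  match k with
  | spherical =>
      exists eta : R, (eta = 1 \/ eta = -1) /\
      ((forall l, I l ->
          Y l = c / sqrt (l ^ 2 - a) /\
          eta * Z l = sqrt (1 - Y l ^ 2) * cosh (Psi l) /\
          eta * W l = sqrt (1 - Y l ^ 2) * sinh (Psi l) /\
          range_spherical_a a c l)
       \/
       (forall l, I l ->
          Y l = c / sqrt (l ^ 2 - a) /\
          eta * Z l = sqrt (Y l ^ 2 - 1) * sinh (Psi l) /\
          eta * W l = sqrt (Y l ^ 2 - 1) * cosh (Psi l) /\
          range_spherical_b a c l))
  | hyperbolic1 =>
      forall l, I l ->
        W l = c / sqrt (l ^ 2 - a) /\
        X l = sqrt (1 + W l ^ 2) * cos (Psi l) /\
        Y l = sqrt (1 + W l ^ 2) * sin (Psi l) /\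
        range_hyperbolic1 a c l
  | parabolic =>
      forall l, I l ->
        Z l = c / sqrt (l ^ 2 - a) /\
        X l = Psi l * Z l /\
        W l = (1 - X l ^ 2) / (2 * Z l) /\
        range_parabolic a l
  end.

(* Main.v *)
(* The profile curve C lies in the 3-dimensional Lorentzian space of the
   hyperplane v = 0, where C, C' and the normal N form an orthonormal frame.
   Expanding the vector e dual to the radius rho (so <e,C> = rho) in this frame gives
   (lambda rho)^2 = rho^2 + rho'^2 - delta and kappa lambda rho = rho + rho''.
   Hence kappa = a / lambda turns into rho'' = (a - 1) rho: the curvature
   K = - rho'' / rho is constant, and the first integral
   c^2 = rho'^2 - (a - 1) rho^2 - delta becomes (lambda^2 - a) rho^2 = c^2.
   The angle theta of C around the axis has theta' = Om / (rho^2 - delta) with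
   Om^2 = (lambda rho)^2; as Om, rho' and lambda never vanish they have constant
   sign, and the chain rule shows that theta is Psi_1 as a function of lambda. *)
Require Import Defs.
From Stdlib Require Import Reals.
From Coquelicot Require Import Coquelicot.
From Stdlib Require Import Ranalysis5 Lra Psatz FunctionalExtensionality.
Open Scope R_scope.

(** * Gram identities for Lorentzian forms in dimension three *)

(* Covers both coordinate systems: (p, q) = (1, 0) is the diagonal form, and
   (p, q) = (0, 1) has two null coordinates. *)
Definition lorentz (p q x1 x2 x3 y1 y2 y3 : R) : R :=
  x1 * y1 + p * (x2 * y2 - x3 * y3) + q * (x2 * y3 + x3 * y2).

Definition det3 (a b c d e f g h i : R) : R :=
  a * (e * i - f * h) - b * (d * i - f * g) + c * (d * h - e * g).

(** In the standard basis the form has a matrix of determinant [- (p ^ 2 + q ^ 2)], so this is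
    multiplicativity of the determinant. The minus sign is what forces the third vector of an
    orthogonal frame to be timelike when the first two are spacelike. *)
Lemma lorentz_gram3 p q a1 a2 a3 b1 b2 b3 n1 n2 n3 :
  let B := lorentz p q in
  det3 (B a1 a2 a3 a1 a2 a3) (B b1 b2 b3 a1 a2 a3) (B n1 n2 n3 a1 a2 a3)
       (B a1 a2 a3 b1 b2 b3) (B b1 b2 b3 b1 b2 b3) (B n1 n2 n3 b1 b2 b3)
       (B a1 a2 a3 n1 n2 n3) (B b1 b2 b3 n1 n2 n3) (B n1 n2 n3 n1 n2 n3)
  = - (p ^ 2 + q ^ 2) * det3 a1 a2 a3 b1 b2 b3 n1 n2 n3 ^ 2.
Proof. unfold det3, lorentz; ring. Qed.

Lemma lorentz_sym p q a1 a2 a3 b1 b2 b3 :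
  lorentz p q a1 a2 a3 b1 b2 b3 = lorentz p q b1 b2 b3 a1 a2 a3.
Proof. unfold lorentz; ring. Qed.

(** Four vectors in dimension three are dependent, so the products of [a], [b], [n], [d] with [a],
    [b], [n], [e] form a singular 4x4 matrix. The identity is the expansion of its determinant along
    the row of [d]. *)
Lemma lorentz_gram4 p q a1 a2 a3 b1 b2 b3 n1 n2 n3 d1 d2 d3 e1 e2 e3 :
  let B := lorentz p q in
  let ea := B e1 e2 e3 a1 a2 a3 in
  let eb := B e1 e2 e3 b1 b2 b3 in
  let en := B e1 e2 e3 n1 n2 n3 in
  let aa := B a1 a2 a3 a1 a2 a3 in
  let bb := B b1 b2 b3 b1 b2 b3 in
  let nn := B n1 n2 n3 n1 n2 n3 in
  let ab := B a1 a2 a3 b1 b2 b3 in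
  let na := B n1 n2 n3 a1 a2 a3 in
  let nb := B n1 n2 n3 b1 b2 b3 in
  let da := B d1 d2 d3 a1 a2 a3 in
  let db := B d1 d2 d3 b1 b2 b3 in
  let dn := B d1 d2 d3 n1 n2 n3 in
  let de := B d1 d2 d3 e1 e2 e3 in
  de * det3 aa ab na ab bb nb na nb nn
  = da * det3 ea eb en ab bb nb na nb nn
    + db * det3 aa ab na ea eb en na nb nn
    + dn * det3 aa ab na ab bb nb ea eb en.
Proof. unfold det3, lorentz; ring. Qed.

(* The relation is the vanishing of the Gram determinant of four vectors
   against four vectors; the 3x3 Gram determinant forces <n,n> = -1. *)
Lemma lorentz_frame p q a1 a2 a3 b1 b2 b3 n1 n2 n3 d1 d2 d3 e1 e2 e3 :
  p ^ 2 + q ^ 2 = 1 ->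
  lorentz p q a1 a2 a3 a1 a2 a3 = 1 ->
  lorentz p q b1 b2 b3 b1 b2 b3 = 1 ->
  lorentz p q a1 a2 a3 b1 b2 b3 = 0 ->
  Rabs (lorentz p q n1 n2 n3 n1 n2 n3) = 1 ->
  lorentz p q n1 n2 n3 a1 a2 a3 = 0 ->
  lorentz p q n1 n2 n3 b1 b2 b3 = 0 ->
  lorentz p q d1 d2 d3 e1 e2 e3 =
    lorentz p q d1 d2 d3 a1 a2 a3 * lorentz p q e1 e2 e3 a1 a2 a3
    + lorentz p q d1 d2 d3 b1 b2 b3 * lorentz p q e1 e2 e3 b1 b2 b3
    - lorentz p q d1 d2 d3 n1 n2 n3 * lorentz p q e1 e2 e3 n1 n2 n3.
Proof.
  intros hpq haa hbb hab hnn hna hnb.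
  pose proof (lorentz_gram3 p q a1 a2 a3 b1 b2 b3 n1 n2 n3) as g3.
  pose proof (lorentz_gram4 p q a1 a2 a3 b1 b2 b3 n1 n2 n3 d1 d2 d3 e1 e2 e3) as g4.
  cbv zeta in g3, g4.
  rewrite (lorentz_sym p q b1), (lorentz_sym p q a1 a2 a3 n1),
    (lorentz_sym p q b1 b2 b3 n1), haa, hbb, hab, hna, hnb, hpq in g3.
  rewrite haa, hbb, hab, hna, hnb in g4.
  unfold det3 at 1 in g3.
  assert (0 <= det3 a1 a2 a3 b1 b2 b3 n1 n2 n3 ^ 2) by apply pow2_ge_0.
  assert (hn : lorentz p q n1 n2 n3 n1 n2 n3 = -1)
    by (revert hnn; unfold Rabs; destruct Rcase_abs; lra).
  rewrite hn in g4; unfold det3 in g4; lra.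
Qed.

(** * Constancy and sign of functions on open intervals *)

Lemma open_interval_convex I a b t :
  Defs.open_interval I -> I a -> I b -> a <= t <= b -> I t.
Proof.
  intros (p & q & _ & h) ha hb ht; apply h in ha, hb; apply h.
  destruct p, q; simpl in *; intuition lra.
Qed.

Lemma open_interval_inhabited I : Defs.open_interval I -> exists t, I t.
Proof.
  intros (p & q & hpq & h).
  destruct p as [p| |], q as [q| |]; simpl in hpq; try contradiction;
    [exists ((p + q) / 2) | exists (p + 1) | exists (q - 1) | exists 0];
    apply h; simpl; intuition lra.
Qed.

Lemma open_interval_locally I t : Defs.open_interval I -> I t -> locally t I.
Proof.
  intros (p & q & _ & h) ht.
  apply h in ht; apply (locally_interval _ t p q); try tauto.
  intros s hp hq; apply h; auto.
Qed.

Lemma constant_of_zero_derivative I f a b :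
  Defs.open_interval I -> (forall t, I t -> is_derive f t 0) -> I a -> I b ->
  f a = f b.
Proof.
  intros hI hf ha hb.
  assert (lt : forall a b, I a -> I b -> a < b -> f a = f b).
  { intros u v hu hv huv; apply (eq_is_derive (V := R_NormedModule) f u v); auto.
    intros t ht; apply hf, (open_interval_convex I u v); auto. }
  destruct (Rtotal_order a b) as [h | [-> | h]]; auto.
  symmetry; auto.
Qed.

Lemma constant_sign I f :
  Defs.open_interval I -> (forall t, I t -> continuous f t) ->
  (forall t, I t -> f t <> 0) ->
  exists s, (s = 1 \/ s = -1) /\ forall t, I t -> 0 < s * f t.
Proof.
  intros hI hc hn.
  (* The factor [s] turns a downward crossing of zero into an upward one, so one appeal to the
     intermediate value theorem covers both. *)
  assert (lt : forall s a b, s <> 0 -> I a -> I b -> a < b -> ~ (s * f a < 0 < s * f b)).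
  { intros s a b hs ha hb hab [h1 h2].
    destruct (IVT_interv (fun t => s * f t) a b) as (z & hz & hz0); auto.
    - intros t ht. apply continuity_pt_filterlim.
      apply (continuous_mult (fun _ => s) f); [apply continuous_const|].
      apply hc, (open_interval_convex I a b); auto.
    - apply (hn z); [apply (open_interval_convex I a b); auto|].
      apply Rmult_integral in hz0; tauto. }
  destruct (open_interval_inhabited I hI) as [t0 h0].
  set (s := if Rlt_dec 0 (f t0) then 1 else -1).
  assert (hs : (s = 1 \/ s = -1) /\ 0 < s * f t0).
  { specialize (hn t0 h0); unfold s; destruct Rlt_dec; split; auto; lra. }
  exists s; split; [tauto|]; intros t ht; destruct hs as [hs hs0].
  destruct (Rlt_dec 0 (s * f t)) as [|hneg]; auto; exfalso.
  specialize (hn t ht).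
  assert (s * f t < 0) by (destruct hs as [-> | ->]; lra).
  destruct (Rtotal_order t t0) as [h | [-> | h]].
  - apply (lt s t t0); auto; lra.
  - lra.
  - apply (lt (- s) t0 t); auto; lra.
Qed.

(** The curvature relations give only the squares of [Om] and of the derivative of [rho]; this
    recovers the values themselves once their signs are known. *)
Lemma eq_of_sqr_eq s f g :
  (s = 1 \/ s = -1) -> 0 < s * f -> 0 <= g -> f ^ 2 = g ^ 2 -> f = s * g.
Proof. intros [-> | ->] ? ? ?; nra. Qed.

Lemma continuous_Rmult (f g : R -> R) t :
  continuous f t -> continuous g t -> continuous (fun s => f s * g s) t.
Proof. exact (continuous_mult f g t). Qed.

Lemma continuous_Rplus (f g : R -> R) t :
  continuous f t -> continuous g t -> continuous (fun s => f s + g s) t.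
Proof. exact (continuous_plus f g t). Qed.

Lemma continuous_Rminus (f g : R -> R) t :
  continuous f t -> continuous g t -> continuous (fun s => f s - g s) t.
Proof. exact (continuous_minus f g t). Qed.

(** * Differentiable hyperbolic and circular angles along plane curves *)

Lemma cosh_sqr t : cosh t ^ 2 = 1 + sinh t ^ 2.
Proof.
  assert (exp t * exp (- t) = 1) by (rewrite <- exp_plus, Rplus_opp_r; apply exp_0).
  unfold cosh, sinh; nra.
Qed.

Lemma cosh_pos t : 0 < cosh t.
Proof.
  assert (h1 := exp_pos t); assert (h2 := exp_pos (- t)); unfold cosh; lra.
Qed.

(** Since [f ^ 2 > g ^ 2], the function [f] has a constant sign [s]. Multiplied by [s] and divided
    by its length [r], the curve lies on the branch of the unit hyperbola parameterized by
    [(cosh, sinh)], where [arcsinh] of the second coordinate is a global angle. *)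
Lemma hyperbolic_angle J (f g : R -> R) :
  Defs.open_interval J ->
  (forall u, J u -> ex_derive f u /\ ex_derive g u) ->
  (forall u, J u -> 0 < f u ^ 2 - g u ^ 2) ->
  exists (theta : R -> R) (eta : R), (eta = 1 \/ eta = -1) /\
    forall u, J u ->
      is_derive theta u
        ((f u * Derive g u - g u * Derive f u) / (f u ^ 2 - g u ^ 2)) /\
      eta * f u = sqrt (f u ^ 2 - g u ^ 2) * cosh (theta u) /\
      eta * g u = sqrt (f u ^ 2 - g u ^ 2) * sinh (theta u).
Proof.
  intros hJ hd hpos.
  destruct (constant_sign J f hJ) as (s & hs & hsf).
  { intros t ht; apply @ex_derive_continuous, hd, ht. }
  { intros t ht h0; specialize (hpos t ht); rewrite h0 in hpos; nra. }
  set (r := fun u => sqrt (f u ^ 2 - g u ^ 2)).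
  assert (hr : forall u, J u -> 0 < r u) by (intros; apply sqrt_lt_R0; auto).
  assert (hr2 : forall u, J u -> r u ^ 2 = f u ^ 2 - g u ^ 2)
    by (intros; apply pow2_sqrt, Rlt_le; auto).
  assert (hr' : forall u, J u ->
    is_derive r u ((f u * Derive f u - g u * Derive g u) / r u)).
  { intros u hu; destruct (hd u hu); specialize (hpos u hu).
    assert (0 < r u) by auto.
    unfold r at 1; auto_derive; [repeat split; auto; lra|].
    replace (sqrt _) with (r u) by (unfold r; f_equal; ring).
    change (fun x => f x) with f; change (fun x => g x) with g.
    field; lra. }
  exists (fun u => arcsinh (s * g u / r u)), s.
  split; auto; intros u hu.
  fold (r u); rewrite <- hr2 by auto; clearbody r.
  destruct (hd u hu) as [hf hg].
  specialize (hpos u hu); specialize (hsf u hu); specialize (hr u hu);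
    specialize (hr2 u hu); specialize (hr' u hu).
  assert (hs2 : s ^ 2 = 1) by (destruct hs as [-> | ->]; ring).
  (* The equation of the unit hyperbola. It evaluates the square root in the derivative of [arcsinh]
     and identifies the hyperbolic cosine of the angle. *)
  assert (hroot : (s * g u / r u) ^ 2 + 1 = (s * f u / r u) ^ 2).
  { replace ((s * f u / r u) ^ 2) with (s ^ 2 * f u ^ 2 / r u ^ 2) by (field; lra).
    replace (f u ^ 2) with (r u ^ 2 + g u ^ 2) by lra; field [hs2].
    lra. }
  assert (hq : 0 < s * f u / r u) by (apply Rdiv_lt_0_compat; auto).
  split; [| split].
  - evar_last.
    + apply (is_derive_comp arcsinh).
      * apply is_derive_Reals, derivable_pt_lim_arcsinh.
      * auto_derive; [repeat split; auto; try lra; eexists; exact hr' | reflexivity].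
    + change (fun x => f x) with f; change (fun x => g x) with g.
      change (fun x => r x) with r; rewrite (is_derive_unique _ _ _ hr').
      rewrite hroot, sqrt_pow2 by lra.
      unfold scal; simpl; unfold mult; simpl.
      assert (s <> 0 /\ f u <> 0) as [] by (split; intros h; rewrite h in hsf; lra).
      transitivity ((Derive g u * r u ^ 2 - g u * (f u * Derive f u - g u * Derive g u))
                    / (f u * r u ^ 2)); [field; lra|].
      change (r u * (r u * 1)) with (r u ^ 2); rewrite hr2; field; lra.
  - assert (h := cosh_sqr (arcsinh (s * g u / r u))).
    rewrite sinh_arcsinh, Rplus_comm, hroot in h.
    assert (h' := cosh_pos (arcsinh (s * g u / r u))).
    replace (cosh _) with (s * f u / r u) by nra. field; lra.
  - rewrite sinh_arcsinh; field; lra.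
Qed.

Lemma exists_angle X Y : X ^ 2 + Y ^ 2 = 1 -> exists t, cos t = X /\ sin t = Y.
Proof.
  intros h.
  assert (hX : -1 <= X <= 1) by nra.
  assert (hY : sqrt (1 - X²) = Rabs Y).
  { rewrite <- sqrt_Rsqr_abs; f_equal; unfold Rsqr; nra. }
  destruct (Rle_dec 0 Y).
  - exists (acos X); rewrite cos_acos, sin_acos, hY, Rabs_right by lra; auto.
  - exists (- acos X).
    rewrite cos_neg, sin_neg, cos_acos, sin_acos, hY, Rabs_left by lra; lra.
Qed.

(** Supplies the circular angle below: the angle of a curve around the origin may leave the range of
    every inverse trigonometric function, so it is obtained by integration. *)
Lemma antiderivative J (phi : R -> R) u0 y0 :
  Defs.open_interval J -> (forall u, J u -> continuous phi u) -> J u0 ->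
  exists F : R -> R, F u0 = y0 /\ forall u, J u -> is_derive F u (phi u).
Proof.
  intros hJ hc h0; exists (fun u => y0 + RInt phi u0 u); split.
  { rewrite (RInt_point (V := R_CompleteNormedModule)); apply Rplus_0_r. }
  intros u hu; evar_last; [|apply Rplus_0_l].
  apply (is_derive_plus (fun _ => y0)); [apply (is_derive_const y0)|].
  apply (is_derive_RInt phi _ u0); auto.
  apply (filter_imp J); [|apply open_interval_locally; auto].
  intros t ht; apply (RInt_correct (V := R_CompleteNormedModule)).
  apply (ex_RInt_continuous (V := R_CompleteNormedModule)); intros s hs; apply hc.
  destruct (Rle_dec u0 t).
  - rewrite Rmin_left, Rmax_right in hs by lra.
    apply (open_interval_convex J u0 t); auto.
  - rewrite Rmin_right, Rmax_left in hs by lra.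
    apply (open_interval_convex J t u0); auto.
Qed.

(** The angle is the integral of the expected angular speed [phi], started at an angle that is
    correct at one point [u0]. It stays correct because [(f + i g) exp(- i theta) / r] has zero
    derivative. *)
Lemma circular_angle J (f g : R -> R) :
  Defs.open_interval J ->
  (forall u, J u -> ex_derive f u /\ ex_derive g u /\
     continuous (Derive f) u /\ continuous (Derive g) u) ->
  (forall u, J u -> 0 < f u ^ 2 + g u ^ 2) ->
  exists theta : R -> R, forall u, J u ->
    is_derive theta u
      ((f u * Derive g u - g u * Derive f u) / (f u ^ 2 + g u ^ 2)) /\
    f u = sqrt (f u ^ 2 + g u ^ 2) * cos (theta u) /\
    g u = sqrt (f u ^ 2 + g u ^ 2) * sin (theta u).
Proof.
  intros hJ hd hpos.
  set (r := fun u => sqrt (f u ^ 2 + g u ^ 2)).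
  assert (hr : forall u, J u -> 0 < r u) by (intros; apply sqrt_lt_R0; auto).
  assert (hr2 : forall u, J u -> r u ^ 2 = f u ^ 2 + g u ^ 2)
    by (intros; apply pow2_sqrt, Rlt_le; auto).
  assert (hr' : forall u, J u ->
    is_derive r u ((f u * Derive f u + g u * Derive g u) / r u)).
  { intros u hu; destruct (hd u hu) as (? & ? & _); specialize (hpos u hu).
    assert (0 < r u) by auto.
    unfold r at 1; auto_derive; [repeat split; auto; lra|].
    replace (sqrt _) with (r u) by (unfold r; f_equal; ring).
    change (fun x => f x) with f; change (fun x => g x) with g.
    field; lra. }
  destruct (open_interval_inhabited J hJ) as [u0 h0].
  set (phi := fun u => (f u * Derive g u - g u * Derive f u) / (f u ^ 2 + g u ^ 2)).
  destruct (exists_angle (f u0 / r u0) (g u0 / r u0)) as (t0 & hc0 & hs0).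
  { specialize (hr u0 h0); replace 1 with (r u0 ^ 2 / r u0 ^ 2) by (field; lra).
    rewrite hr2 at 1 by auto; field; lra. }
  destruct (antiderivative J phi u0 t0 hJ) as (th & hth0 & hth); auto.
  { intros u hu; destruct (hd u hu) as (hf & hg & hf' & hg'); specialize (hpos u hu).
    apply (@ex_derive_continuous _ R_NormedModule) in hf, hg.
    apply continuous_Rmult;
      [apply continuous_Rminus | apply continuous_comp; [|apply continuous_Rinv; lra];
         apply continuous_Rplus]; repeat apply continuous_Rmult; auto;
      apply continuous_const. }
  exists th; intros u hu; fold (r u); split; [apply hth; auto|].
  clearbody r.
  (* In complex form, [(f + i g)' = (m + i phi) (f + i g)] with [m = r' / r]. *)
  assert (log_derivative : forall t, J t -> exists m,
    Derive f t = f t * m - g t * phi t /\ Derive g t = g t * m + f t * phi t /\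
    Derive r t = r t * m /\ Derive th t = phi t).
  { intros t ht; exists ((f t * Derive f t + g t * Derive g t) / r t ^ 2).
    rewrite (is_derive_unique _ _ _ (hr' t ht)), (is_derive_unique _ _ _ (hth t ht)).
    specialize (hr t ht); specialize (hpos t ht); specialize (hr2 t ht).
    unfold phi; rewrite hr2; repeat split; try (field; lra).
    rewrite <- hr2; field; lra. }
  (* Real and imaginary parts of [(f + i g) exp(- i theta) / r]; this quantity is constant and
     equals 1 at [u0] by the choice of [t0]. *)
  assert (key : (f u * cos (th u) + g u * sin (th u)) / r u = 1 /\
                (g u * cos (th u) - f u * sin (th u)) / r u = 0).
  { assert (hr0 := hr u0 h0); split.
    - rewrite (constant_of_zero_derivative J
        (fun u => (f u * cos (th u) + g u * sin (th u)) / r u) u u0); auto.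
      + rewrite hth0, hc0, hs0.
        transitivity ((f u0 ^ 2 + g u0 ^ 2) / r u0 ^ 2); [field; lra|].
        rewrite hr2 by auto; field; rewrite <- hr2 by auto; nra.
      + intros t ht; destruct (hd t ht) as (hf & hg & _).
        specialize (hr t ht).
        assert (ex_derive r t) by (eexists; apply hr'; auto).
        assert (ex_derive th t) by (eexists; apply hth; auto).
        destruct (log_derivative t ht) as (m & hf1 & hg1 & hr1 & hth1).
        auto_derive; [repeat split; auto; lra|].
        change (fun x => f x) with f; change (fun x => g x) with g;
          change (fun x => r x) with r; change (fun x => th x) with th;
          rewrite hf1, hg1, hr1, hth1; field; lra.
    - rewrite (constant_of_zero_derivative J
        (fun u => (g u * cos (th u) - f u * sin (th u)) / r u) u u0); auto.
      + rewrite hth0, hc0, hs0; field; lra.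
      + intros t ht; destruct (hd t ht) as (hf & hg & _).
        specialize (hr t ht).
        assert (ex_derive r t) by (eexists; apply hr'; auto).
        assert (ex_derive th t) by (eexists; apply hth; auto).
        destruct (log_derivative t ht) as (m & hf1 & hg1 & hr1 & hth1).
        auto_derive; [repeat split; auto; lra|].
        change (fun x => f x) with f; change (fun x => g x) with g;
          change (fun x => r x) with r; change (fun x => th x) with th;
          rewrite hf1, hg1, hr1, hth1; field; lra. }
  destruct key as [k1 k2].
  specialize (hr u hu); assert (hcs := sin2_cos2 (th u)); unfold Rsqr in hcs.
  assert (k1' : f u * cos (th u) + g u * sin (th u) = r u)
    by (rewrite <- (Rmult_1_r (r u)), <- k1 at 1; field; lra).
  assert (k2' : g u * cos (th u) - f u * sin (th u) = 0)
    by (rewrite <- (Rmult_0_r (r u)), <- k2 at 1; field; lra).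
  (* Rotating back by [theta] solves [k1'] and [k2'] for [f] and [g]. *)
  rewrite <- k1'; split.
  - transitivity (f u * (sin (th u) * sin (th u) + cos (th u) * cos (th u))
      + sin (th u) * 0); [rewrite hcs; ring | rewrite <- k2'; ring].
  - transitivity (g u * (sin (th u) * sin (th u) + cos (th u) * cos (th u))
      - cos (th u) * 0); [rewrite hcs; ring | rewrite <- k2'; ring].
Qed.

(** * Derivatives of the surface and their restriction to the profile curve *)

(* The three coordinates of the profile curve that are not identically zero at
   v = 0. *)
Definition prof1 (k : rot_kind) (x y z w : R -> R) : R -> R :=
  match k with spherical => y | _ => x end.
Definition prof2 (k : rot_kind) (x y z w : R -> R) : R -> R :=
  match k with hyperbolic1 => y | _ => z end.
Definition prof3 (k : rot_kind) (x y z w : R -> R) : R -> R := w.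

Definition profile_form (k : rot_kind) : R -> R -> R -> R -> R -> R -> R :=
  match k with parabolic => lorentz 0 1 | _ => lorentz 1 0 end.

Definition profile_product (k : rot_kind) (x y z w x' y' z' w' : R -> R) (u : R) : R :=
  profile_form k (prof1 k x y z w u) (prof2 k x y z w u) (prof3 k x y z w u)
    (prof1 k x' y' z' w' u) (prof2 k x' y' z' w' u) (prof3 k x' y' z' w' u).

Ltac at_v0 := rewrite ?sin_0, ?cos_0, ?sinh_0, ?cosh_0.

(** At [v = 0] one of the four coordinates vanishes for each kind, so the Minkowski product reduces
    to a three-dimensional Lorentzian form. *)
Lemma mink_profile k x y z w x' y' z' w' u :
  mink k (surf k x y z w u 0) (surf k x' y' z' w' u 0)
  = profile_product k x y z w x' y' z' w' u.
Proof.
  unfold profile_product; destruct k;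
    unfold mink, surf, profile_form, prof3, lorentz, Defs.c1, c2, c3, c4; simpl; at_v0; field.
Qed.

Lemma Dvec_profile k x y z w u :
  Dvec (fun t => surf k x y z w t 0) u
  = surf k (Derive x) (Derive y) (Derive z) (Derive w) u 0.
Proof.
  destruct k; unfold Dvec, surf, Defs.c1, c2, c3, c4; cbn [fst snd]; at_v0;
    rewrite ?Derive_scal_l, ?Derive_scal; repeat apply f_equal2; try ring; auto.
  transitivity (Derive w u); [apply Derive_ext; intros|]; ring.
Qed.

Lemma surf_u_profile k x y z w u :
  surf_u k x y z w u 0 = surf k (Derive x) (Derive y) (Derive z) (Derive w) u 0.
Proof. apply Dvec_profile. Qed.

Lemma surf_uu_profile k x y z w u :
  surf_uu k x y z w u 0
  = surf k (Derive (Derive x)) (Derive (Derive y)) (Derive (Derive z))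
      (Derive (Derive w)) u 0.
Proof.
  unfold surf_uu; rewrite <- Dvec_profile; f_equal.
  apply functional_extensionality; intros t; apply surf_u_profile.
Qed.

(** Needed for every [v], since [surf_vv] differentiates once more in [v] before [v = 0] is set. *)
Lemma surf_v_formula k x y z w u v :
  surf_v k x y z w u v =
  match k with
  | spherical => (y u * cos v, - (y u * sin v), 0, 0)
  | hyperbolic1 => (0, 0, w u * cosh v, w u * sinh v)
  | parabolic => (0, z u, 0, - (v * z u))
  end.
Proof.
  destruct k; unfold surf_v, Dvec, surf, Defs.c1, c2, c3, c4; cbn [fst snd];
    repeat apply f_equal2; apply is_derive_unique; auto_derive; auto; field.
Qed.

(** In each case the value is minus the radius times the constant vector dual to the radius; its
    product with the normal therefore yields the component of that vector along [N]. *)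
Lemma surf_vv_profile k x y z w u :
  surf_vv k x y z w u 0 =
  match k with
  | spherical => (0, - y u, 0, 0)
  | hyperbolic1 => (0, 0, 0, w u)
  | parabolic => (0, 0, 0, - z u)
  end.
Proof.
  unfold surf_vv.
  replace (fun t => surf_v k x y z w u t) with (fun v => match k with
  | spherical => (y u * cos v, - (y u * sin v), 0, 0)
  | hyperbolic1 => (0, 0, w u * cosh v, w u * sinh v)
  | parabolic => (0, z u, 0, - (v * z u))
  end) by (apply functional_extensionality; intros; symmetry; apply surf_v_formula).
  destruct k; unfold Dvec, Defs.c1, c2, c3, c4; cbn [fst snd];
    repeat apply f_equal2; apply is_derive_unique; auto_derive; auto; at_v0; field.
Qed.

Lemma mink_surf_v k x y z w u v :
  mink k (surf_v k x y z w u v) (surf_v k x y z w u v) = radius k x y z w u ^ 2.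
Proof.
  rewrite surf_v_formula; destruct k; unfold mink, radius, Defs.c1, c2, c3, c4; cbn [fst snd].
  - assert (h := sin2_cos2 v); unfold Rsqr in h.
    transitivity (y u ^ 2 * (sin v * sin v + cos v * cos v)); [ring|].
    rewrite h; ring.
  - assert (h := cosh_sqr v).
    transitivity (w u ^ 2 * (cosh v ^ 2 - sinh v ^ 2)); [ring|].
    rewrite h; ring.
  - ring.
Qed.

(** * Relations along the profile curve and its angle around the axis *)

Lemma lorentz_derive p q (f1 f2 f3 g1 g2 g3 : R -> R) u :
  ex_derive f1 u -> ex_derive f2 u -> ex_derive f3 u ->
  ex_derive g1 u -> ex_derive g2 u -> ex_derive g3 u ->
  is_derive (fun t => lorentz p q (f1 t) (f2 t) (f3 t) (g1 t) (g2 t) (g3 t)) u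
    (lorentz p q (Derive f1 u) (Derive f2 u) (Derive f3 u) (g1 u) (g2 u) (g3 u)
     + lorentz p q (f1 u) (f2 u) (f3 u) (Derive g1 u) (Derive g2 u) (Derive g3 u)).
Proof.
  intros; unfold lorentz; auto_derive; [repeat split; auto|].
  change (fun x => f1 x) with f1; change (fun x => f2 x) with f2;
    change (fun x => f3 x) with f3; change (fun x => g1 x) with g1;
    change (fun x => g2 x) with g2; change (fun x => g3 x) with g3; ring.
Qed.

Lemma derive_of_constant J (f : R -> R) c l u :
  Defs.open_interval J -> J u -> (forall t, J t -> f t = c) ->
  is_derive f u l -> l = 0.
Proof.
  intros hJ hu hc hf; apply is_derive_unique in hf; rewrite <- hf.
  rewrite (Derive_ext_loc f (fun _ => c)); [apply Derive_const|].
  apply (filter_imp J); auto; apply open_interval_locally; auto.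
Qed.

(** The coordinates as functions of arc length, before passing to lambda. The bounds on [y u ^ 2]
    are recorded because they later decide which parameter range applies. In the parabolic case
    [theta] is the parameter [x / z] of the null rotations. *)
Definition angle_formulas (k : rot_kind) (J : R -> Prop) (theta x y z w : R -> R) : Prop :=
  match k with
  | spherical =>
      exists eta : R, (eta = 1 \/ eta = -1) /\
      ((forall u, J u -> y u ^ 2 < 1 /\
          eta * z u = sqrt (1 - y u ^ 2) * cosh (theta u) /\
          eta * w u = sqrt (1 - y u ^ 2) * sinh (theta u))
       \/
       (forall u, J u -> 1 < y u ^ 2 /\
          eta * w u = sqrt (y u ^ 2 - 1) * cosh (theta u) /\
          eta * z u = sqrt (y u ^ 2 - 1) * sinh (theta u)))
  | hyperbolic1 =>
      forall u, J u ->
        x u = sqrt (1 + w u ^ 2) * cos (theta u) /\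
        y u = sqrt (1 + w u ^ 2) * sin (theta u)
  | parabolic =>
      forall u, J u ->
        x u = theta u * z u /\ w u = (1 - x u ^ 2) / (2 * z u)
  end.

Section Geometry.

Variables (k : rot_kind) (J : R -> Prop) (x y z w : R -> R).
Hypothesis hM : rotational_surface k 1 J x y z w.

Let f1 := prof1 k x y z w.
Let f2 := prof2 k x y z w.
Let f3 := prof3 k x y z w.
Let rho := radius k x y z w.

Lemma profile_smooth u : J u ->
  (ex_derive f1 u /\ ex_derive (Derive f1) u /\ continuous (Derive (Derive f1)) u) /\
  (ex_derive f2 u /\ ex_derive (Derive f2) u /\ continuous (Derive (Derive f2)) u) /\
  (ex_derive f3 u /\ ex_derive (Derive f3) u /\ continuous (Derive (Derive f3)) u).
Proof.
  intros hu; destruct hM as [_ hs _ _ _ _ _]; destruct hs as (h1 & h2 & h3 & h4).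
  assert (ext : forall g h : R -> R, (forall t, g t = h t) -> C2_on J g ->
    ex_derive h u /\ ex_derive (Derive h) u /\ continuous (Derive (Derive h)) u).
  { intros g h e; replace h with g by (apply functional_extensionality; auto); auto. }
  unfold f1, f2, f3, prof1, prof2, prof3; destruct k; split; [|split| |split| |split];
    [refine (ext _ _ _ h2) | refine (ext _ _ _ h3) | refine (ext _ _ _ h4)
    | refine (ext _ _ _ h1) | refine (ext _ _ _ h2) | refine (ext _ _ _ h4)
    | refine (ext _ _ _ h1) | refine (ext _ _ _ h3) | refine (ext _ _ _ h4)];
    intros; unfold Defs.c1, c2, c3, c4; simpl; at_v0; ring.
Qed.

Lemma rho_smooth u : J u ->
  ex_derive rho u /\ ex_derive (Derive rho) u /\ continuous (Derive (Derive rho)) u.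
Proof.
  intros hu; destruct (profile_smooth u hu) as (h1 & h2 & h3).
  unfold rho, f1, f2, f3 in *; destruct k; auto.
Qed.

Let form := profile_form k.
Let D1 := Derive f1.
Let D2 := Derive f2.
Let D3 := Derive f3.

(** With [C] the profile curve, the last three relations come from differentiating [<C,C> = 1],
    [<C',C'> = 1] and [<C,C'> = 0]; the value -1 is [- <C',C'>]. *)
Lemma curve_relations u : J u ->
  form (f1 u) (f2 u) (f3 u) (f1 u) (f2 u) (f3 u) = 1 /\
  form (D1 u) (D2 u) (D3 u) (D1 u) (D2 u) (D3 u) = 1 /\
  form (f1 u) (f2 u) (f3 u) (D1 u) (D2 u) (D3 u) = 0 /\
  form (Derive D1 u) (Derive D2 u) (Derive D3 u) (D1 u) (D2 u) (D3 u) = 0 /\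
  form (Derive D1 u) (Derive D2 u) (Derive D3 u) (f1 u) (f2 u) (f3 u) = -1.
Proof.
  assert (hJ := rs_interval _ _ _ _ _ _ _ hM).
  assert (e0 : forall t, J t -> form (f1 t) (f2 t) (f3 t) (f1 t) (f2 t) (f3 t) = 1).
  { intros t ht; rewrite <- (rs_deSitter _ _ _ _ _ _ _ hM t ht).
    symmetry; apply mink_profile. }
  assert (e1 : forall t, J t -> form (D1 t) (D2 t) (D3 t) (D1 t) (D2 t) (D3 t) = 1).
  { intros t ht; rewrite <- (rs_arc_length _ _ _ _ _ _ _ hM t ht).
    cbv zeta; rewrite Dvec_profile, mink_profile.
    unfold profile_product, D1, D2, D3, f1, f2, f3, prof1, prof2, prof3, form.
    destruct k; reflexivity. }
  assert (hpq : exists p q, form = lorentz p q)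
    by (unfold form; destruct k; simpl; eauto).
  destruct hpq as (p & q & hpq).
  rewrite hpq in *.
  assert (e2 : forall t, J t -> lorentz p q (f1 t) (f2 t) (f3 t) (D1 t) (D2 t) (D3 t) = 0).
  { intros t ht; destruct (profile_smooth t ht) as ((? & _) & (? & _) & ? & _).
    pose proof (derive_of_constant J _ _ _ t hJ ht e0
      (lorentz_derive p q f1 f2 f3 f1 f2 f3 t
        ltac:(assumption) ltac:(assumption) ltac:(assumption)
        ltac:(assumption) ltac:(assumption) ltac:(assumption))) as h.
    fold D1 D2 D3 in h; rewrite lorentz_sym in h; lra. }
  intros hu; destruct (profile_smooth u hu) as ((? & ? & _) & (? & ? & _) & ? & ? & _).
  pose proof (derive_of_constant J _ _ _ u hJ hu e1
    (lorentz_derive p q D1 D2 D3 D1 D2 D3 u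
        ltac:(assumption) ltac:(assumption) ltac:(assumption)
        ltac:(assumption) ltac:(assumption) ltac:(assumption))) as h1.
  pose proof (derive_of_constant J _ _ _ u hJ hu e2
    (lorentz_derive p q f1 f2 f3 D1 D2 D3 u
        ltac:(assumption) ltac:(assumption) ltac:(assumption)
        ltac:(assumption) ltac:(assumption) ltac:(assumption))) as h2.
  fold D1 D2 D3 in h2; rewrite e1 in h2 by auto.
  rewrite (lorentz_sym p q (D1 u)) in h1.
  rewrite (lorentz_sym p q (f1 u)) in h2.
  repeat split; auto; lra.
Qed.

Lemma gauss_curvature_formula u v : J u ->
  gauss_curvature k 1 x y z w u v = - Derive (Derive rho) u / rho u.
Proof.
  intros hu; unfold gauss_curvature.
  assert (hJ := rs_interval _ _ _ _ _ _ _ hM).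
  assert (e : forall t, J t ->
    sqrt (mink k (surf_v k x y z w t v) (surf_v k x y z w t v)) = rho t).
  { intros t ht; rewrite mink_surf_v; apply sqrt_pow2, Rlt_le.
    apply (rs_radius _ _ _ _ _ _ _ hM t ht). }
  rewrite e by auto.
  rewrite (Derive_ext_loc _ (Derive rho)); [unfold Rdiv; ring|].
  (* The square root equals [rho] only on [J]; as [J] is open, the derivatives of both orders still
     agree. *)
  apply (filter_imp J); [|apply open_interval_locally; auto].
  intros t ht; apply Derive_ext_loc.
  apply (filter_imp J); [auto | apply open_interval_locally; auto].
Qed.

(** [Om] is the Wronskian of the two coordinates complementary to the radius. Its square follows
    from Lagrange's identity (Euclidean or Lorentzian) or a direct expansion in null coordinates,
    together with the relations for [<C,C>], [<C',C'>] and [<C,C'>]. *)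
Lemma profile_angle :
  (forall u, J u -> rho u ^ 2 - delta k <> 0) ->
  exists theta Om : R -> R,
    (forall u, J u -> continuous Om u /\
       Om u ^ 2 = rho u ^ 2 + Derive rho u ^ 2 - delta k /\
       is_derive theta u (Om u / (rho u ^ 2 - delta k))) /\
    angle_formulas k J theta x y z w.
Proof.
  intros hne; assert (hJ := rs_interval _ _ _ _ _ _ _ hM).
  assert (hrel := curve_relations); assert (hsm := profile_smooth).
  assert (hpos := rs_radius _ _ _ _ _ _ _ hM).
  unfold rho, form, D1, D2, D3, f1, f2, f3, prof1, prof2, prof3, radius, delta in *.
  assert (hsmc : forall f : R -> R, forall u, ex_derive f u /\ ex_derive (Derive f) u
    /\ continuous (Derive (Derive f)) u -> continuous f u /\ continuous (Derive f) u).
  { intros f u (h1 & h2 & _); split;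
      apply (@ex_derive_continuous _ R_NormedModule); auto. }
  destruct k; cbn [profile_form angle_formulas] in *; unfold lorentz in *.
  - set (Om := fun u => w u * Derive z u - z u * Derive w u).
    assert (hOm : forall u, J u -> continuous Om u /\
      Om u ^ 2 = y u ^ 2 + Derive y u ^ 2 - 1).
    { intros u hu; destruct (hsm u hu) as (hy & hz & hw).
      destruct (hsmc _ _ hz), (hsmc _ _ hw); split.
      - apply continuous_Rminus; apply continuous_Rmult; assumption.
      - destruct (hrel u hu) as (r00 & r11 & r01 & _).
        transitivity ((z u * Derive z u - w u * Derive w u) ^ 2
          - (z u * z u - w u * w u) * (Derive z u * Derive z u - Derive w u * Derive w u));
          [unfold Om; ring|].
        replace (z u * Derive z u - w u * Derive w u) with (- (y u * Derive y u)) by lra.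
        replace (z u * z u - w u * w u) with (1 - y u * y u) by lra.
        replace (Derive z u * Derive z u - Derive w u * Derive w u)
          with (1 - Derive y u * Derive y u) by lra.
        ring. }
    (* Either [y > 1] throughout, and [(w, z)] runs on a hyperbola branch with [w] as the [cosh]
       coordinate, or [y < 1] throughout, and the roles of [z] and [w] are exchanged. *)
    destruct (constant_sign J (fun u => y u ^ 2 - 1) hJ) as (s & [-> | ->] & hs); auto.
    { intros u hu; destruct (hsm u hu) as (hy & _); destruct (hsmc _ _ hy).
      apply continuous_Rminus; [|apply continuous_const].
      repeat apply continuous_Rmult; auto; apply continuous_const. }
    + destruct (hyperbolic_angle J w z hJ) as (theta & eta & heta & h).
      { intros u hu; destruct (hsm u hu) as (_ & (? & _) & ? & _); auto. }
      { intros u hu; specialize (hs u hu); destruct (hrel u hu) as (r00 & _); nra. }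
      assert (e : forall u, J u -> w u ^ 2 - z u ^ 2 = y u ^ 2 - 1)
        by (intros u hu; destruct (hrel u hu) as (r00 & _); nra).
      exists theta, Om; split.
      * intros u hu; destruct (hOm u hu); do 2 (split; [assumption|]).
        rewrite <- e by auto; apply h; auto.
      * exists eta; split; auto; right; intros u hu.
        specialize (hs u hu); destruct (h u hu) as (_ & h1 & h2).
        rewrite <- e by auto; repeat split; auto; lra.
    + destruct (hyperbolic_angle J z w hJ) as (theta & eta & heta & h).
      { intros u hu; destruct (hsm u hu) as (_ & (? & _) & ? & _); auto. }
      { intros u hu; specialize (hs u hu); destruct (hrel u hu) as (r00 & _); nra. }
      assert (e : forall u, J u -> z u ^ 2 - w u ^ 2 = 1 - y u ^ 2)
        by (intros u hu; destruct (hrel u hu) as (r00 & _); nra).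
      exists theta, Om; split.
      * intros u hu; destruct (hOm u hu); do 2 (split; [assumption|]).
        destruct (h u hu) as (h0 & _); rewrite e in h0 by auto.
        (* Exchanging [z] and [w] negates both numerator and denominator, so the same [Om] serves in
           both cases. *)
        specialize (hs u hu); evar_last; [exact h0|]; unfold Om; field; lra.
      * exists eta; split; auto; left; intros u hu.
        specialize (hs u hu); destruct (h u hu) as (_ & h1 & h2).
        rewrite <- e by auto; repeat split; auto; lra.
  - destruct (circular_angle J x y hJ) as (theta & h).
    { intros u hu; destruct (hsm u hu) as (hx & hy & _).
      destruct (hsmc _ _ hx), (hsmc _ _ hy); tauto. }
    { intros u hu; destruct (hrel u hu) as (r00 & _); nra. }
    assert (e : forall u, J u -> x u ^ 2 + y u ^ 2 = 1 + w u ^ 2)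
      by (intros u hu; destruct (hrel u hu) as (r00 & _); nra).
    exists theta, (fun u => x u * Derive y u - y u * Derive x u); split.
    + intros u hu; destruct (hsm u hu) as (hx & hy & _).
      destruct (hsmc _ _ hx), (hsmc _ _ hy); split; [|split].
      * apply continuous_Rminus; apply continuous_Rmult; assumption.
      * destruct (hrel u hu) as (r00 & r11 & r01 & _).
        transitivity ((x u * x u + y u * y u) * (Derive x u * Derive x u + Derive y u * Derive y u)
          - (x u * Derive x u + y u * Derive y u) ^ 2); [ring|].
        replace (x u * Derive x u + y u * Derive y u) with (w u * Derive w u) by lra.
        replace (x u * x u + y u * y u) with (1 + w u * w u) by lra.
        replace (Derive x u * Derive x u + Derive y u * Derive y u)
          with (1 + Derive w u * Derive w u) by lra.
        ring.
      * destruct (h u hu) as (h0 & _); rewrite e in h0 by auto.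
        replace (w u ^ 2 - -1) with (1 + w u ^ 2) by ring; auto.
    + intros u hu; rewrite <- e by auto; apply h; auto.
  - exists (fun u => x u / z u), (fun u => z u * Derive x u - x u * Derive z u); split.
    + intros u hu; destruct (hsm u hu) as (hx & hz & _).
      destruct (hsmc _ _ hx), (hsmc _ _ hz); split; [|split].
      * apply continuous_Rminus; apply continuous_Rmult; assumption.
      * destruct (hrel u hu) as (r00 & r11 & r01 & _).
        transitivity (z u ^ 2 * (Derive x u * Derive x u)
          - 2 * z u * Derive z u * (x u * Derive x u)
          + (x u * x u) * Derive z u ^ 2); [ring|].
        replace (x u * x u) with (1 - 2 * z u * w u) by lra.
        replace (Derive x u * Derive x u) with (1 - 2 * Derive z u * Derive w u) by lra.
        replace (x u * Derive x u) with (- (z u * Derive w u + w u * Derive z u)) by lra.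
        ring.
      * specialize (hpos u hu).
        auto_derive; [repeat split; try tauto; lra|].
        change (fun t => x t) with x; change (fun t => z t) with z; field; lra.
    + intros u hu; specialize (hpos u hu); destruct (hrel u hu) as (r00 & _).
      split; [field; lra|].
      replace (1 - x u ^ 2) with (2 * z u * w u) by lra; field; lra.
Qed.

Variable N : R -> R -> E41.
Hypothesis hN : unit_normal k J x y z w N.

(** Let [e] be the constant vector with [<e,C> = rho], so [<e,e> = delta k]. Expanding [<e,e>] and
    [<C'',e> = rho''] in the frame [C], [C'], [N] by [lorentz_frame] gives the two equations,
    because [<e,N> = - lambda rho] and [<C'',N> = kappa]. *)
Lemma curvature_relations u : J u ->
  (lambda k x y z w N u 0 * rho u) ^ 2
    = rho u ^ 2 + Derive rho u ^ 2 - delta k /\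
  kappa k x y z w N u 0 * (lambda k x y z w N u 0 * rho u)
    = rho u + Derive (Derive rho) u.
Proof.
  intros hu.
  assert (hv : v_domain k 0) by (destruct k; simpl; auto; assert (h := PI_RGT_0); lra).
  destruct (hN u 0 hu hv) as (hnn & hn0 & hn1 & hn2).
  destruct (curve_relations u hu) as (r00 & r11 & r01 & r21 & r20).
  assert (hrho := rs_radius _ _ _ _ _ _ _ hM u hu).
  assert (frame : exists m1 m2 m3 e1 e2 e3,
    (Rabs (form m1 m2 m3 m1 m2 m3) = 1 /\
     form m1 m2 m3 (f1 u) (f2 u) (f3 u) = 0 /\
     form m1 m2 m3 (D1 u) (D2 u) (D3 u) = 0) /\
    (form e1 e2 e3 (f1 u) (f2 u) (f3 u) = rho u /\
     form e1 e2 e3 (D1 u) (D2 u) (D3 u) = Derive rho u /\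
     form (Derive D1 u) (Derive D2 u) (Derive D3 u) e1 e2 e3
       = Derive (Derive rho) u /\
     form e1 e2 e3 e1 e2 e3 = delta k) /\
    lambda k x y z w N u 0 * rho u = - form e1 e2 e3 m1 m2 m3 /\
    kappa k x y z w N u 0
      = form (Derive D1 u) (Derive D2 u) (Derive D3 u) m1 m2 m3).
  { rewrite surf_v_formula in hn2; rewrite surf_u_profile in hn1.
    unfold Defs.lambda, kappa; rewrite mink_surf_v, surf_vv_profile, surf_uu_profile.
    destruct (N u 0) as [[[n1 n2] n3] n4].
    unfold D1, D2, D3, f1, f2, f3, form, rho, radius, prof1, prof2, prof3, delta in *.
    destruct k; cbn [profile_form] in *;
      unfold mink, surf, lorentz, Defs.c1, c2, c3, c4 in *; cbn [fst snd] in *;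
      rewrite ?sin_0, ?cos_0, ?sinh_0, ?cosh_0 in *.
    (* Orthogonality to the rotation direction removes one component of the normal, leaving [m] in
       dimension three. The vectors [e] are [(1,0,0)], [(0,0,-1)] and [(0,0,1)], with squares 1, -1
       and 0 in the respective forms. *)
    - assert (n1 = 0) by nra; subst n1; exists n2, n3, n4, 1, 0, 0.
      repeat split; try (field; lra); try lra; refine (eq_trans _ hnn); f_equal; ring.
    - assert (n3 = 0) by nra; subst n3; exists n1, n2, n4, 0, 0, (-1).
      repeat split; try (field; lra); try lra; refine (eq_trans _ hnn); f_equal; ring.
    - assert (n2 = 0) by nra; subst n2; exists n1, n3, n4, 0, 0, 1.
      repeat split; try (field; lra); try lra; refine (eq_trans _ hnn); f_equal; ring. }
  destruct frame as (m1 & m2 & m3 & e1 & e2 & e3 & (hmm & hm0 & hm1)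
    & (he0 & he1 & he2 & hee) & hl & hk).
  assert (hpq : exists p q, form = lorentz p q /\ p ^ 2 + q ^ 2 = 1)
    by (unfold form; destruct k; simpl; do 2 eexists; split; try reflexivity; ring).
  destruct hpq as (p & q & hpq & hpq1); rewrite hpq in *.
  assert (fr := fun d1 d2 d3 => lorentz_frame p q _ _ _ _ _ _ _ _ _ d1 d2 d3 e1 e2 e3
                  hpq1 r00 r11 r01 hmm hm0 hm1).
  rewrite hl, hk; split.
  - specialize (fr e1 e2 e3); rewrite hee, he0, he1 in fr; nra.
  - specialize (fr (Derive D1 u) (Derive D2 u) (Derive D3 u)).
    rewrite he0, he1, he2, r20, r21 in fr; lra.
Qed.

End Geometry.

(** Serves to extend the equation for [rho''] across a point where lambda would vanish. *)
Lemma continuous_eq_at J (h g : R -> R) u0 :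
  Defs.open_interval J -> J u0 -> continuous h u0 -> continuous g u0 ->
  (forall u, J u -> u <> u0 -> h u = g u) -> h u0 = g u0.
Proof.
  intros hJ h0 hc hg he.
  destruct (Req_dec (h u0 - g u0) 0) as [|hn]; [lra|exfalso].
  assert (hl : locally u0 (fun u => h u - g u <> 0)).
  { apply (continuous_Rminus h g u0 hc hg (fun d => d <> 0)).
    apply (open_neq 0 (h u0 - g u0)); auto. }
  destruct (filter_and _ _ (open_interval_locally J u0 hJ h0) hl) as [eps heps].
  assert (heps0 := cond_pos eps).
  (* Any point of the neighbourhood other than [u0] gives the contradiction. *)
  destruct (heps (u0 + eps / 2)) as [h1 h2].
  { unfold ball; simpl; unfold AbsRing_ball, abs, minus, plus, opp; simpl.
    replace (u0 + eps / 2 + - u0) with (eps / 2) by ring.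
    rewrite Rabs_right; lra. }
  apply h2; rewrite he; auto; lra.
Qed.

(** * Parameter ranges implied by the well-definedness inequalities *)

Lemma outside_sqrt b l : 0 <= b -> b < l ^ 2 -> outside (sqrt b) l.
Proof.
  intros hb hl; assert (h := sqrt_pos b); assert (h' := pow2_sqrt b hb).
  unfold outside; destruct (Rle_dec 0 l); [right | left]; nra.
Qed.

Lemma between_sqrt b b' l :
  0 <= b -> b < l ^ 2 < b' -> between (sqrt b) (sqrt b') l.
Proof.
  intros hb [h1 h2]; assert (h := sqrt_pos b); assert (h' := pow2_sqrt b hb).
  assert (hb' : 0 <= b') by lra.
  assert (k := sqrt_pos b'); assert (k' := pow2_sqrt b' hb').
  unfold between; destruct (Rle_dec 0 l); [right | left]; split; nra.
Qed.

(** The second hypothesis is the condition [y < 1] for [y = c / sqrt (l ^ 2 - a)]. *)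
Lemma spherical_a_range a c l :
  0 < l ^ 2 - a -> c ^ 2 < l ^ 2 - a -> range_spherical_a a c l.
Proof.
  intros h1 h2; unfold range_spherical_a.
  destruct (Rlt_dec (- c ^ 2) a); [left|right; lra].
  split; auto; apply outside_sqrt; lra.
Qed.

(** The condition [y > 1] bounds [l ^ 2] above by [c ^ 2 + a]. Below, it is bounded by both [a] and
    [(c ^ 2 + a) / (c ^ 2 + 1)]; their difference has the sign of [1 - a], which decides the
    stronger bound. *)
Lemma spherical_b_range a c l :
  0 < c -> well_defined_at spherical a c l -> l ^ 2 - a < c ^ 2 ->
  range_spherical_b a c l.
Proof.
  intros hc (h1 & _ & h3) h2; simpl delta in h3; unfold range_spherical_b.
  assert (0 <= l ^ 2) by apply pow2_ge_0; assert (0 < c ^ 2) by nra.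
  destruct (Rtotal_order a 1) as [ha | [-> | ha]].
  - left; split; [lra|]; apply between_sqrt; [apply Rdiv_le_0_compat; lra|].
    split; [apply Rlt_div_l; lra | lra].
  - right; right; split; auto; rewrite <- sqrt_1 at 1; apply between_sqrt; lra.
  - right; left; split; auto; apply between_sqrt; lra.
Qed.

(** The last inequality reads [(c ^ 2 - 1) * l ^ 2 > c ^ 2 - a]: a lower bound on [l ^ 2] for
    [c > 1], an upper bound for [c < 1], and just [a > 1] for [c = 1]. It is combined with
    [l ^ 2 > a]. *)
Lemma hyperbolic1_range a c l :
  0 < c -> well_defined_at hyperbolic1 a c l -> range_hyperbolic1 a c l.
Proof.
  intros hc (h1 & _ & h3); simpl delta in h3; unfold range_hyperbolic1.
  destruct (Rtotal_order c 1) as [hc1 | [-> | hc1]].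
  - assert (hc2 : c ^ 2 < 1) by nra.
    assert (0 < (l ^ 2 - a) * (1 - c ^ 2)) by (apply Rmult_lt_0_compat; lra).
    (* An upper bound [(a - c ^ 2) / (1 - c ^ 2)] exceeding the lower bound [a] means [a > 1]. *)
    assert (ha : 1 < a) by (assert (0 < c ^ 2) by nra; nra).
    do 4 right; split; [auto | split; [auto|]]; apply between_sqrt; [lra|].
    split; [lra | apply -> Rlt_div_r; lra].
  - do 3 right; left; split; [lra | split; [auto|]]; apply outside_sqrt; lra.
  - assert (hc2 : 1 < c ^ 2) by nra.
    destruct (Rtotal_order a 1) as [ha | [-> | ha]].
    + right; left; split; [auto | split; [auto|]].
      apply outside_sqrt; [apply Rdiv_le_0_compat; lra | apply Rlt_div_l; lra].
    + right; right; left; split; [auto | split; [auto|]].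
      rewrite <- sqrt_1; apply outside_sqrt; lra.
    + left; split; [auto | split; [auto|]]; apply outside_sqrt; lra.
Qed.

Lemma parabolic_range a c l :
  0 < c -> well_defined_at parabolic a c l -> range_parabolic a l.
Proof.
  intros hc (h1 & _ & h3); simpl delta in h3; unfold range_parabolic.
  destruct (Rlt_dec 1 a); [left | right]; split; try lra.
  - apply outside_sqrt; lra.
  - rewrite <- sqrt_1; apply outside_sqrt; nra.
Qed.

(** * Consequences of the Weingarten relation: the radius and the angle in terms of lambda *)

Section Weingarten.

Variables (k : rot_kind) (J I : R -> Prop) (x y z w : R -> R).
Variables (N : R -> R -> E41) (U : R -> R) (a : R).
Hypothesis hM : rotational_surface k 1 J x y z w.
Hypothesis hN : unit_normal k J x y z w N.
Hypothesis hU : parameterized_by_lambda k J I x y z w N U.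
Hypothesis hW : forall u v, J u -> v_domain k v ->
  kappa k x y z w N u v = a / lambda k x y z w N u v.
Hypothesis hI : forall l, I l -> 0 < l ^ 2 - a.

Let rho := radius k x y z w.

Lemma v_domain_0 : v_domain k 0.
Proof. destruct k; simpl; auto; assert (h := PI_RGT_0); lra. Qed.

Lemma lambda_U l : I l -> lambda k x y z w N (U l) 0 = l.
Proof. intros hl; apply hU; auto; apply v_domain_0. Qed.

Lemma rho_pos u : J u -> 0 < rho u.
Proof. exact (rs_radius _ _ _ _ _ _ _ hM u). Qed.

Lemma J_open : Defs.open_interval J.
Proof. exact (rs_interval _ _ _ _ _ _ _ hM). Qed.

Lemma J_U l : I l -> J (U l).
Proof. apply hU. Qed.

Lemma radius_ode_nonzero l : I l -> l <> 0 ->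
  Derive (Derive rho) (U l) = (a - 1) * rho (U l).
Proof.
  intros hl hl0; assert (hu := J_U l hl).
  destruct (curvature_relations k J x y z w hM N hN (U l) hu) as [_ h].
  rewrite hW, lambda_U in h by auto using v_domain_0; fold rho in h.
  replace (a / l * (l * rho (U l))) with (a * rho (U l)) in h by (field; auto); lra.
Qed.

(* At lambda = 0 the junk value a / 0 = 0 makes the Weingarten relation force
   rho'' = - rho there; since rho'' is continuous this means a = 0. *)
Lemma parameter_nonzero l : I l -> l <> 0.
Proof.
  intros hl ->; assert (hu := J_U 0 hl); assert (ha := hI 0 hl).
  destruct (curvature_relations k J x y z w hM N hN (U 0) hu) as [_ h].
  rewrite hW, lambda_U in h by auto using v_domain_0; fold rho in h.
  assert (hr := rho_pos _ hu).
  destruct (rho_smooth k J x y z w hM (U 0) hu) as (hr1 & _ & hr2).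
  fold rho in hr1, hr2.
  assert (e : Derive (Derive rho) (U 0) = (a - 1) * rho (U 0)).
  { apply (continuous_eq_at J (Derive (Derive rho)) (fun u => (a - 1) * rho u));
      auto using J_open.
    - apply continuous_Rmult; [apply continuous_const|].
      apply (@ex_derive_continuous _ R_NormedModule); auto.
    - intros u hu' hne; destruct hU as (_ & _ & hs & _).
      destruct (hs u hu') as (l & hl' & <-).
      apply radius_ode_nonzero; auto; intros ->; auto. }
  (* Now [h] says [a * rho = 0], while [ha] says [a < 0] and the radius is positive. *)
  rewrite e, Rmult_0_l, Rmult_0_r in h; nra.
Qed.

Lemma radius_ode u : J u -> Derive (Derive rho) u = (a - 1) * rho u.
Proof.
  intros hu; destruct hU as (_ & _ & hs & _); destruct (hs u hu) as (l & hl & <-).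
  apply radius_ode_nonzero; auto; apply parameter_nonzero; auto.
Qed.

(** The energy of the linear equation [rho'' = (a - 1) rho]. *)
Lemma first_integral_constant : exists A,
  forall u, J u -> Derive rho u ^ 2 - (a - 1) * rho u ^ 2 = A.
Proof.
  destruct (open_interval_inhabited J J_open) as [u0 h0].
  exists (Derive rho u0 ^ 2 - (a - 1) * rho u0 ^ 2); intros u hu.
  apply (constant_of_zero_derivative J
    (fun u => Derive rho u ^ 2 - (a - 1) * rho u ^ 2)); auto using J_open.
  intros t ht; destruct (rho_smooth k J x y z w hM t ht) as (h1 & h2 & _).
  fold rho in h1, h2; auto_derive; [repeat split; auto|].
  change (fun x => rho x) with rho; change (fun x => Derive rho x) with (Derive rho).
  rewrite radius_ode by auto; ring.
Qed.

(** Subtracting the first integral, with value [A], from the relation for [(lambda rho) ^ 2] leaves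
    [(lambda ^ 2 - a) rho ^ 2 = A - delta k]. The left side is positive, so [c] is the square root
    of the right side. *)
Lemma radius_as_function_of_lambda : exists c, 0 < c /\
  (forall l, I l -> rho (U l) = c / sqrt (l ^ 2 - a)) /\
  (forall u, J u -> Derive rho u ^ 2 = (a - 1) * rho u ^ 2 + c ^ 2 + delta k).
Proof.
  destruct first_integral_constant as [A hA].
  assert (hc : forall l, I l -> (l ^ 2 - a) * rho (U l) ^ 2 = A - delta k).
  { intros l hl; assert (hu := J_U l hl).
    destruct (curvature_relations k J x y z w hM N hN (U l) hu) as [h _].
    rewrite lambda_U in h by auto; fold rho in h; rewrite <- (hA (U l)) by auto; lra. }
  assert (hpos : 0 < A - delta k).
  { destruct (open_interval_inhabited I (proj1 hU)) as [l hl]; rewrite <- (hc l hl).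
    assert (h := rho_pos _ (J_U l hl)); specialize (hI l hl).
    apply Rmult_lt_0_compat; auto; nra. }
  exists (sqrt (A - delta k)); split; [apply sqrt_lt_R0; auto|split].
  - intros l hl; specialize (hI l hl); assert (h := rho_pos _ (J_U l hl)).
    assert (0 < sqrt (l ^ 2 - a)) by (apply sqrt_lt_R0; auto).
    rewrite <- (hc l hl), sqrt_mult, sqrt_pow2 by nra; field; lra.
  - intros u hu; rewrite pow2_sqrt by lra; rewrite <- (hA u hu); ring.
Qed.

(** The derivative of [U] comes from differentiating [rho (U l) = c / sqrt (l ^ 2 - a)]. Both [Om]
    and [rho'] are known up to sign as functions of lambda, and constancy of these signs yields a
    single [s] on all of [I]. *)
Lemma angle_derivative c (Om theta : R -> R) :
  0 < c ->
  (forall l, I l -> rho (U l) = c / sqrt (l ^ 2 - a)) ->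
  (forall u, J u -> Derive rho u ^ 2 = (a - 1) * rho u ^ 2 + c ^ 2 + delta k) ->
  (forall l, I l -> well_defined_at k a c l) ->
  (forall u, J u -> continuous Om u /\
       Om u ^ 2 = rho u ^ 2 + Derive rho u ^ 2 - delta k /\
       is_derive theta u (Om u / (rho u ^ 2 - delta k))) ->
  exists s, (s = 1 \/ s = -1) /\
    forall l, I l ->
      is_derive (fun l => theta (U l)) l (s * c ^ 2 * Psi1_integrand k a c l).
Proof.
  intros hc hrho hdrho hwd htheta.
  assert (hIo := proj1 hU).
  assert (hOm2 : forall l, I l -> Om (U l) ^ 2 = (l * rho (U l)) ^ 2).
  { intros l hl; destruct (htheta _ (J_U l hl)) as (_ & -> & _).
    destruct (curvature_relations k J x y z w hM N hN (U l) (J_U l hl)) as [h _].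
    rewrite lambda_U in h by auto; fold rho in h; lra. }
  (* The numerator is the third expression of [well_defined_at]; its positivity keeps [rho'] away
     from zero. *)
  assert (hdrho2 : forall l, I l -> Derive rho (U l) ^ 2 =
    ((l ^ 2 - 1) * c ^ 2 + delta k * (l ^ 2 - a)) / (l ^ 2 - a)).
  { intros l hl; specialize (hI l hl); rewrite hdrho, hrho by auto using J_U.
    replace ((c / sqrt (l ^ 2 - a)) ^ 2) with (c ^ 2 / sqrt (l ^ 2 - a) ^ 2)
      by (field; apply Rgt_not_eq, sqrt_lt_R0; auto).
    rewrite pow2_sqrt by lra; field; lra. }
  destruct (constant_sign I (fun l => l) hIo) as (sg & hsg & hsg').
  { intros; apply continuous_id. }
  { exact parameter_nonzero. }
  destruct (constant_sign J Om J_open) as (om & hom & hom').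
  { intros u hu; apply htheta; auto. }
  { intros u hu h0; destruct hU as (_ & _ & hs & _); destruct (hs u hu) as (l & hl & <-).
    specialize (hOm2 l hl); rewrite h0 in hOm2.
    assert (h := rho_pos _ hu); assert (h' := parameter_nonzero l hl).
    assert (hp : l * rho (U l) <> 0) by (apply Rmult_integral_contrapositive; lra).
    apply hp; nra. }
  destruct (constant_sign J (Derive rho) J_open) as (ta & hta & hta').
  { intros u hu; apply (@ex_derive_continuous _ R_NormedModule).
    apply (rho_smooth k J x y z w hM u hu). }
  { intros u hu h0; destruct hU as (_ & _ & hs & _); destruct (hs u hu) as (l & hl & <-).
    specialize (hdrho2 l hl); rewrite h0 in hdrho2.
    destruct (hwd l hl) as (h1 & _ & h3).
    assert (0 < ((l ^ 2 - 1) * c ^ 2 + delta k * (l ^ 2 - a)) / (l ^ 2 - a))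
      by (apply Rdiv_lt_0_compat; auto); lra. }
  (* The factors are the signs of [Om], [rho'] and lambda; the minus sign comes from
     [c / sqrt (l ^ 2 - a)], whose derivative is [- c * l / sqrt (l ^ 2 - a) ^ 3]. *)
  exists (- (om * ta * sg)); split.
  { destruct hom as [-> | ->], hta as [-> | ->], hsg as [-> | ->]; lra. }
  intros l hl; assert (hu := J_U l hl).
  destruct (hwd l hl) as (h1 & h2 & h3).
  destruct (rho_smooth k J x y z w hM (U l) hu) as (hr1 & _); fold rho in hr1.
  destruct hU as (_ & hUd & _); destruct (hUd l hl) as [_ hUl].
  assert (hS := sqrt_lt_R0 _ h1); assert (hS2 := pow2_sqrt _ (Rlt_le _ _ h1)).
  assert (hT := sqrt_lt_R0 _ h3); assert (hT2 := pow2_sqrt _ (Rlt_le _ _ h3)).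
  assert (chain : Derive U l * Derive rho (U l) = - c * l / sqrt (l ^ 2 - a) ^ 3).
  { rewrite <- (is_derive_unique (fun l => rho (U l)) l (Derive U l * Derive rho (U l))).
    - rewrite (Derive_ext_loc _ (fun l => c / sqrt (l ^ 2 - a))).
      + apply is_derive_unique; auto_derive;
          replace (l * (l * 1) + - a) with (l ^ 2 - a) by ring.
        * repeat split; auto; lra.
        * field; lra.
      + apply (filter_imp I); [auto | apply open_interval_locally; auto].
    - apply (is_derive_comp rho U); apply Derive_correct; auto. }
  evar_last.
  { apply (is_derive_comp theta U); [apply htheta; auto | apply Derive_correct; auto]. }
  unfold scal; simpl; unfold mult; simpl.
  assert (eOm : Om (U l) = om * (sg * l * rho (U l))).
  { apply eq_of_sqr_eq; auto.
    - apply Rmult_le_pos; [apply Rlt_le, hsg'; auto | apply Rlt_le, rho_pos; auto].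
    - rewrite hOm2 by auto; destruct hsg as [-> | ->]; ring. }
  set (S := sqrt (l ^ 2 - a)) in *.
  set (T := sqrt ((l ^ 2 - 1) * c ^ 2 + delta k * (l ^ 2 - a))) in *.
  assert (eD : Derive rho (U l) = ta * (T / S)).
  { apply eq_of_sqr_eq; auto.
    - apply Rlt_le, Rdiv_lt_0_compat; auto.
    - rewrite hdrho2 by auto; rewrite <- hT2, <- hS2; field; lra. }
  rewrite eD in chain.
  assert (eU : Derive U l = - c * l * ta / (S ^ 2 * T)).
  { assert (ta <> 0 /\ ta * ta = 1) as [] by (destruct hta as [-> | ->]; lra).
    (* Inserting [ta * ta = 1] isolates the left side of [chain], so that the sign ends up in the
       numerator. *)
    replace (Derive U l) with ((Derive U l * (ta * (T / S))) * (ta * ta) * S / (ta * T))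
      by (replace (ta * ta) with 1; field; lra).
    rewrite chain; field; lra. }
  unfold Psi1_integrand; fold S T.
  rewrite eU, eOm, hrho by auto; fold S.
  clearbody T S; rewrite <- hS2 in *.
  field; repeat split; lra.
Qed.

End Weingarten.

(** * Constant curvature and the explicit coordinates *)

Theorem corollary3p5 (k : rot_kind) (J I : R -> Prop) (x y z w : R -> R)
    (N : R -> R -> E41) (U : R -> R) (a : R)
    (hM : rotational_surface k 1 J x y z w)
    (hN : unit_normal k J x y z w N)
    (hU : parameterized_by_lambda k J I x y z w N U)
    (hW : forall u v, J u -> v_domain k v ->
            kappa k x y z w N u v = a / lambda k x y z w N u v)
    (hI : forall l, I l -> 0 < l ^ 2 - a) :
  (exists K : R, forall u v, J u -> v_domain k v ->
     gauss_curvature k 1 x y z w u v = K) /\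
  exists c : R, 0 < c /\
    (forall l, I l -> radius k x y z w (U l) = c / sqrt (l ^ 2 - a)) /\
    ((forall l, I l -> well_defined_at k a c l) ->
     exists (psi0 : R) (Psi : R -> R),
       is_Psi1 k I a c psi0 Psi /\
       coordinate_formulas k I a c Psi
         (fun l => x (U l)) (fun l => y (U l))
         (fun l => z (U l)) (fun l => w (U l))).
Proof.
  split.
  (* The curvature is [- rho'' / rho] with [rho'' = (a - 1) rho]. *)
  { exists (1 - a); intros u v hu _.
    rewrite (gauss_curvature_formula k J x y z w hM u v hu).
    rewrite (radius_ode k J I x y z w N U a hM hN hU hW hI u hu).
    assert (h := rs_radius _ _ _ _ _ _ _ hM u hu); field; lra. }
  destruct (radius_as_function_of_lambda k J I x y z w N U a hM hN hU hW hI)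
    as (c & hc & hrho & hdrho).
  exists c; split; [auto | split; [auto|]]; intros hwd.
  assert (hJU : forall l, I l -> J (U l)) by (apply hU).
  assert (hsq : forall l, I l ->
    (l ^ 2 - a) * radius k x y z w (U l) ^ 2 = c ^ 2).
  { intros l hl; specialize (hI l hl); rewrite hrho by auto.
    rewrite <- (pow2_sqrt (l ^ 2 - a)) at 1 by lra.
    field; apply Rgt_not_eq, sqrt_lt_R0; auto. }
  destruct (profile_angle k J x y z w hM) as (theta & Om & htheta & hform).
  (* By [hsq], [c ^ 2 - delta k * (l ^ 2 - a)] equals [(l ^ 2 - a) * (rho ^ 2 - delta k)], so the
     second condition of [well_defined_at] keeps the denominator of the angular speed nonzero. *)
  { intros u hu h0; destruct hU as (_ & _ & hs & _); destruct (hs u hu) as (l & hl & <-).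
    destruct (hwd l hl) as (_ & h2 & _); apply h2; rewrite <- (hsq l hl).
    replace (radius k x y z w (U l) ^ 2) with (delta k) by lra; ring. }
  destruct (angle_derivative k J I x y z w N U a hM hN hU hW hI c Om theta
              hc hrho hdrho hwd htheta) as (s & hs & hPsi).
  (* The angle itself is [Psi], with its additive constant absorbed in the antiderivative, hence
     [psi0 = 0]. Since [s ^ 2 = 1], the antiderivative [s / c ^ 2 * theta] gives back [theta] after
     multiplication by [s * c ^ 2]. *)
  exists 0, (fun l => theta (U l)); split.
  { exists s, (fun l => s / c ^ 2 * theta (U l)); split; [auto | split]; intros l hl.
    - specialize (hPsi l hl).
      evar_last; [apply (is_derive_scal (fun l => theta (U l))); exact hPsi|].
      destruct hs as [-> | ->]; field; lra.
    - destruct hs as [-> | ->]; field; lra. }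
  destruct k; simpl in hform; simpl radius in *; simpl.
  - destruct hform as (eta & heta & [h | h]); exists eta; split; auto; [left | right];
      intros l hl; specialize (hI l hl); specialize (hsq l hl);
      destruct (h _ (hJU l hl)) as (h0 & h1 & h2);
      (split; [auto | split; [auto | split; [auto|]]]).
    (* By [hsq], comparing [y ^ 2] with 1 amounts to comparing [c ^ 2] with [l ^ 2 - a]. *)
    + apply spherical_a_range; auto; nra.
    + apply spherical_b_range; auto; nra.
  - intros l hl; destruct (hform _ (hJU l hl)) as (h1 & h2).
    split; [auto | split; [auto | split; [auto|]]].
    apply (hyperbolic1_range a c l hc); auto.
  - intros l hl; destruct (hform _ (hJU l hl)) as (h1 & h2).
    split; [auto | split; [auto | split; [auto|]]].
    apply (parabolic_range a c l hc); auto.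
Qed.
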